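(* Let $r\geq 3$ and let $\mathcal{G}$, $\mathcal{H}$ and $\Gamma$ be $r$-uniform supertrees, where $\mathcal{G}$ and $\mathcal{H}$ have the same number of vertices. Let $u\in V(\mathcal{G})$ and $v\in V(\mathcal{H})$. If $\varphi(\mathcal{G},x)=\varphi(\mathcal{H},x)$ and $\varphi(\mathcal{G}-u,x)=\varphi(\mathcal{H}-v,x)$, then for every $w\in V(\Gamma)$ we have $\rho(\mathcal{G}(u,w)\Gamma)=\rho(\mathcal{H}(v,w)\Gamma)$ and $ME(\mathcal{G}(u,w)\Gamma)=ME(\mathcal{H}(v,w)\Gamma)$.
   Context: An $r$-uniform supertree is a connected acyclic hypergraph each of whose edges has exactly $r$ vertices. For an $r$-uniform hypergraph $\mathcal{H}$ on $n$ vertices, $m(\mathcal{H},k)$ is the number of sets of $k$ pairwise disjoint edges ($m(\mathcal{H},0)=1$) and the matching polynomial is $\varphi(\mathcal{H},x)=\sum_{k\geq 0}(-1)^k m(\mathcal{H},k)x^{n-kr}$. The matching energy $ME(\mathcal{H})$ is the sum of the absolute values of all roots (with multiplicity) of $\varphi(\mathcal{H},x)$. The adjacency tensor of $\mathcal{H}$ with vertex set $[n]$ is the order-$r$, dimension-$n$ tensor $\mathcal{A}=(a_{i_1\cdots i_r})$ with $a_{i_1\cdots i_r}=1/(r-1)!$ if $\{i_1,\dots,i_r\}$ is an edge and $0$ otherwise; $\lambda\in\mathbb{C}$ is an eigenvalue if there is nonzero $x\in\mathbb{C}^n$ with $\sum_{i_2,\dots,i_r}a_{ii_2\cdots i_r}x_{i_2}\cdots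 x_{i_r}=\lambda x_i^{r-1}$ for all $i$, and the spectral radius $\rho(\mathcal{H})$ is the maximum modulus of the eigenvalues. $\mathcal{H}-u$ is obtained by deleting vertex $u$ and all edges containing it. $\mathcal{G}(u,w)\Gamma$ is obtained from disjoint $\mathcal{G},\Gamma$ by identifying $u\in V(\mathcal{G})$ with $w\in V(\Gamma)$. *)

(* Defs.v *)
From HB Require Import structures.
From mathcomp Require Import all_boot all_order all_algebra.
From mathcomp Require Import complex.
From mathcomp Require Import classical_sets reals.
Set Implicit Arguments. Unset Strict Implicit. Unset Printing Implicit Defensive.
Import Order.TTheory GRing.Theory Num.Theory.
Local Open Scope ring_scope.

Record hgraph (T : finType) := HGraph { hV : {set T} ; hE : {set {set T}} }.

Section Hyper.
Variable T : finType.
Implicit Types (H : hgraph T) (r : nat).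

Definition wf_hgraph H := forall e, e \in hE H -> e \subset hV H.

Definition uniform r H := forall e, e \in hE H -> #|e| = r.

Definition hadj H : rel T :=
  fun x y => [exists e in hE H, (x \in e) && (y \in e)].

Definition hconnected H :=
  forall x y, x \in hV H -> y \in hV H -> connect (hadj H) x y.

Definition has_berge_cycle H :=
  exists k (f : 'I_k -> T) (g : 'I_k -> {set T}),
    [/\ (2 <= k)%N, injective f, injective g &
        forall i, [/\ g i \in hE H, f i \in g i & f (ordS i) \in g i]].

Definition acyclic H := ~ has_berge_cycle H.

Definition supertree r H := [/\ wf_hgraph H, uniform r H, hconnected H & acyclic H].

Definition hdel H (u : T) : hgraph T :=
  HGraph (hV H :\ u) [set e in hE H | u \notin e].

Definition is_matching H (M : {set {set T}}) :=
  (M \subset hE H) &&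
  [forall e1 in M, forall e2 in M, (e1 != e2) ==> [disjoint e1 & e2]].

Definition nmatch H k := #|[set M : {set {set T}} | is_matching H M & #|M| == k]|.

Definition match_poly r H : {poly int} :=
  \sum_(k < #|hE H|.+1) ((-1) ^+ k * (nmatch H k)%:R) *: 'X^(#|hV H| - k * r).

Variable R : realType.
Local Notation C := (R[i]).

Definition match_roots r H : seq C :=
  sval (closed_field_poly_normal (map_poly intr (match_poly r H) : {poly C})).

Definition match_energy r H : R :=
  \sum_(z <- match_roots r H) Normc.normc z.

(* eigenvalues of the adjacency tensor (entries 1/(r-1)! on edges) *)
Definition tensor_eigenvalue r H (l : C) :=
  exists x : T -> C,
    (exists2 i, i \in hV H & x i != 0) /\
    forall i, i \in hV H ->
      \sum_(f : {ffun 'I_r.-1 -> T} | (i |: [set f j | j : 'I_r.-1]) \in hE H)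
         ((r.-1)`!%:R)^-1 * \prod_(j : 'I_r.-1) x (f j)
      = l * x i ^+ r.-1.

Definition spectral_radius r H : R :=
  sup [set y : R | exists l, tensor_eigenvalue r H l /\ y = Normc.normc l].

End Hyper.

Definition coal_map (T1 T3 : finType) (u : T1) (w : T3) (x : T3) : T1 + T3 :=
  if x == w then inl u else inr x.

Definition coalesce (T1 T3 : finType) (G : hgraph T1) (u : T1)
    (Gam : hgraph T3) (w : T3) : hgraph (T1 + T3)%type :=
  HGraph ((@inl T1 T3) @: hV G :|: (@inr T1 T3) @: (hV Gam :\ w))
         ([set (@inl T1 T3) @: (e : {set T1}) | e in hE G] :|:
          [set coal_map u w @: (e : {set T3}) | e in hE Gam]).

(* Main.v *)
(** Cutting a supertree at the glued vertex expresses the matching polynomial of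
    [G(u,w)Gam] through those of [G], [G - u] and data of [Gam] alone, which gives
    equal matching polynomials and hence equal matching energies.

    It remains to see that the matching polynomial determines the spectral radius.
    Give every vertex [v] a weight [a v] and consider the matching sum
    [\sum_M (-1)^|M| \prod_(v not covered by M) a v] and the weighted eigenvalue
    problem [\sum_(e containing v) \prod_(j in e) x j = a v * x v ^ r].  Removing a
    pendant edge [e] with attachment vertex [p] while replacing [a p] by
    [a p - 1 / \prod_(c in e :\ p) a c] multiplies the matching sum by a nonzero
    factor and preserves the existence of a positive solution.  Starting from the
    constant weight [t] and peeling off all edges leaves a single vertex, whose weight
    vanishes at the largest real root of the matching polynomial; so at this root there
    is a positive eigenvector, and comparing moduli with it bounds every eigenvalue. *)
Require Import Defs.
From HB Require Import structures.
From mathcomp Require Import all_boot all_order all_algebra.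
From mathcomp Require Import complex.
From mathcomp Require Import classical_sets reals.
From mathcomp Require Import polyrcf ring.
From mathcomp Require Import fintype finset.
Set Implicit Arguments. Unset Strict Implicit. Unset Printing Implicit Defensive.
Import Order.TTheory GRing.Theory Num.Theory.
Local Open Scope ring_scope.

(** * Growing a supertree edge by edge *)

Section Growth.
Variable T : finType.
Implicit Types (V : {set T}) (E : {set {set T}}) (e : {set T}) (w : T) (r : nat).

(** This gives supertrees an induction principle. Each new edge is pendant, hanging at [p] when it
    is added, so connectedness and acyclicity never have to be mentioned during an induction, and
    read backwards the growth is a peeling order that ends at the root [w]. *)
Inductive grown r w : {set T} -> {set {set T}} -> Prop :=
| Grown0 : grown r w [set w] set0
| GrownS V E p e : grown r w V E -> #|e| = r -> e :&: V = [set p] ->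
    grown r w (e :|: V) (e |: E).

Lemma grown_root r w V E : grown r w V E -> w \in V.
Proof. by elim=> [|{}V {}E p e _ wV _ _]; rewrite ?set11 // inE wV orbT. Qed.

Lemma grown_sub r w V E : grown r w V E -> forall e, e \in E -> e \subset V.
Proof.
elim=> [e|{}V {}E p e _ IH _ _ e']; first by rewrite inE.
rewrite in_setU1 => /predU1P[->|/IH]; first exact: subsetUl.
by move/subset_trans; apply; apply: subsetUr.
Qed.

Lemma grown_card r w V E : grown r w V E -> forall e, e \in E -> #|e| = r.
Proof.
elim=> [e|{}V {}E p e _ IH er _ e']; first by rewrite inE.
by rewrite in_setU1 => /predU1P[->|/IH].
Qed.

Lemma grown_notin r w V E p e : (1 < r)%N -> grown r w V E -> #|e| = r ->
  e :&: V = [set p] -> e \notin E.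
Proof.
move=> r1 gVE er eV; apply: contraTN r1 => /(grown_sub gVE)/setIidPl.
by rewrite eV => eE; rewrite -er -eE cards1.
Qed.

Lemma hadj_sym (H : hgraph T) : symmetric (hadj H).
Proof. by move=> x y; apply: eq_existsb => e; rewrite [X in _ && X]andbC. Qed.

Lemma hadj_subrel V E V' E' : E \subset E' -> subrel (hadj (HGraph V E)) (hadj (HGraph V' E')).
Proof.
move=> sEE' x y /existsP[e /andP[eE xy]].
by apply/existsP; exists e; rewrite (subsetP sEE').
Qed.

Lemma grown_connected r w V E : grown r w V E -> hconnected (HGraph V E).
Proof.
move=> gVE.
have wx x : x \in V -> connect (hadj (HGraph V E)) w x.
  elim: gVE x => [x|{}V {}E p e _ IH _ eV x]; first by rewrite inE => /eqP->.
  have sub y z : connect (hadj (HGraph V E)) y z ->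
      connect (hadj (HGraph (e :|: V) (e |: E))) y z.
    by apply: connect_sub => {}y {}z yz; apply: connect1; apply: hadj_subrel yz; apply: subsetUr.
  have [pe pV] : p \in e /\ p \in V by apply/setIP; rewrite eV set11.
  rewrite inE; case/orP => [xe|/IH/sub//].
  apply: connect_trans (sub _ _ (IH _ pV)) (connect1 _).
  by apply/existsP; exists e; rewrite /= setU11 pe.
move=> x y /= xV yV; apply: connect_trans (wx _ yV).
by rewrite (sym_connect_sym (@hadj_sym _)) wx.
Qed.

(* The new edge closes up a shortest path between two of its vertices; on a
   shortest path no edge can be used twice. *)
Lemma berge_cycle_add V E e a b : connect (hadj (HGraph V E)) a b ->
  a != b -> a \in e -> b \in e -> e \notin E -> has_berge_cycle (HGraph V (e |: E)).
Proof.
move=> /connectP[p0 p0P p0b] ab ae be eE.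
set adj := hadj (HGraph V E) in p0P.
pose Q n := [exists p : n.-tuple T, path adj a p && (last a p == b)].
have Qp (s : seq T) : path adj a s -> last a s = b -> Q (size s).
  by move=> pP pb; apply/existsP; exists (in_tuple s); rewrite /= pP pb eqxx.
have exQ : exists n, Q n by exists (size p0); apply: Qp.
case: (ex_minnP exQ) => n /existsP[p1 /andP[p1P /eqP p1b]] nmin.
have [p [pP pb pU pn]] : exists p, [/\ path adj a p, last a p = b, uniq (a :: p) & size p = n].
  case/shortenP: p1P p1b => p pP pU sp pb; exists p; split=> //.
  apply/eqP; rewrite eqn_leq nmin ?Qp // andbT.
  by rewrite -(size_tuple p1) uniq_leq_size //; case/andP: pU.
have shorter q : path adj a q -> last a q = b -> (n <= size q)%N.
  by move=> qP qb; apply/nmin/Qp.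
have n_gt0 : (0 < n)%N.
  by rewrite -pn; case: {+}p pb ab => //= <-; rewrite eqxx.
pose x i := nth a (a :: p) i.
have x0 : x 0%N = a by [].
have xn : x n = b by rewrite /x -pb -pn nth_last.
have adjx i : (i < n)%N -> adj (x i) (x i.+1).
  by rewrite -pn => lin; apply/(pathP a): lin.
have /fin_all_exists[g0 g0P] (i : 'I_n) : exists g, [/\ g \in E, x i \in g & x i.+1 \in g].
  by have /existsP[g /and3P[? ? ?]] := adjx i (ltn_ord i); exists g.
have g0_lt (i j : 'I_n) : (i < j)%N -> g0 i != g0 j.
  move=> ij; apply/eqP => gij.
  have [giE xi _] := g0P i; have [_ _ xj] := g0P j.
  have jp : (j < size p)%N by rewrite pn.
  have [ip ilj] : (i < size p)%N /\ (i <= j)%N by rewrite pn (ltn_ord i) (ltnW ij).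
  have dj : drop j p = x j.+1 :: drop j.+1 p by rewrite (drop_nth a jp).
  have lti : last a (take i p) = x i.
    rewrite /x -nth_last size_take ip; case: (nat_of_ord i) ip => [|m] lm; first by case: {+}p.
    by rewrite /= nth_take.
  (* If one edge served steps [i < j], it would allow a jump from [x i] straight to [x j.+1], giving
     a path of length [i + (n - j) < n]. *)
  suff: (n <= size (take i p ++ drop j p))%N.
    rewrite size_cat size_take ip size_drop pn leqNgt => /negP[].
    by rewrite -ltn_subRL; rewrite ltn_sub2l // ltn_ord.
  apply: shorter.
    have := pP; rewrite -{1}(cat_take_drop i p) cat_path => /andP[tiP _].
    have := pP; rewrite -{1}(cat_take_drop j p) cat_path => /andP[_].
    rewrite cat_path tiP dj /= lti => /andP[_ ->]; rewrite andbT.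
    by apply/existsP; exists (g0 i); rewrite /= giE xi gij xj.
  by rewrite last_cat -pb -[in RHS](cat_take_drop j p) [in RHS]last_cat dj.
(* The path edges take the indices below [n]; the last index gets [e], where [ordS] wraps around
   from [b] to [a]. *)
pose g (i : 'I_n.+1) := if insub (nat_of_ord i) is Some j then g0 j else e.
have gE i : g i = if unlift ord_max i is Some j then g0 j else e.
  rewrite /g; case: unliftP => [j ->|->] /=.
    by rewrite /bump leqNgt ltn_ord (valK j).
  by rewrite insubF ?ltnn.
exists n.+1, (fun i : 'I_n.+1 => x i), g; split=> //.
- move=> i j /eqP; rewrite /x nth_uniq //= ?pn ?ltn_ord // => /eqP ij.
  exact: val_inj.
- move=> i j; rewrite !gE.
  case: unliftP => [i' ->|->]; case: unliftP => [j' ->|->] // gij.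
  + case: (ltngtP i' j') => [/g0_lt|/g0_lt|ij]; rewrite ?gij ?eqxx //.
    by congr lift; apply: val_inj.
  + by have [giE _ _] := g0P i'; rewrite gij (negPf eE) in giE.
  + by have [giE _ _] := g0P j'; rewrite -gij (negPf eE) in giE.
- move=> i; rewrite gE; case: unliftP => [j ->|->] /=.
    have [gE' xj xj1] := g0P j.
    rewrite in_setU1 gE' orbT; split=> //; first by rewrite /bump leqNgt ltn_ord.
    by rewrite /bump leqNgt ltn_ord modn_small // ltnS ltn_ord.
  by rewrite setU11 xn; split=> //; rewrite modnn x0.
Qed.

Lemma has_berge_cycle_sub V E V' E' : E \subset E' ->
  has_berge_cycle (HGraph V E) -> has_berge_cycle (HGraph V' E').
Proof.
move=> sEE' [k [f [g [k2 fI gI fg]]]]; exists k, f, g; split=> // i.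
by have [gE ? ?] := fg i; split=> //; apply: (subsetP sEE').
Qed.

Lemma supertree_grown r (H : hgraph T) w : (0 < r)%N -> supertree r H -> w \in hV H ->
  grown r w (hV H) (hE H).
Proof.
case: H => V E r0 [wfH unH conH acH] /= wV.
suff grow V' E' : grown r w V' E' -> E' \subset E -> V' \subset V -> grown r w V E.
  by apply: (grow [set w] set0); rewrite ?sub0set ?sub1set //; apply: Grown0.
have [n] := ubnP #|E :\: E'|; elim: n => // n IH in V' E' * => le_n gVE' sE sV.
case: (pickP [pred e in E :\: E' | e :&: V' != set0]) => [e|none].
  rewrite inE in_setD => /andP[/andP[eE' eE] /set0Pn[p /setIP[pe pV']]].
  have eV' : e :&: V' = [set p].
    apply/eqP; rewrite eqEsubset sub1set inE pe pV' !andbT.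
    apply/subsetP => q; rewrite !inE => /andP[qe qV']; apply: contraT => qp.
    case: acH; apply: (@has_berge_cycle_sub V' (e |: E')).
      by rewrite subUset sub1set eE.
    by apply: (berge_cycle_add (grown_connected gVE' qV' pV') qp).
  apply: (IH (e :|: V') (e |: E')).
  - move: le_n; rewrite ltnS; apply/leq_trans/proper_card.
    apply/properP; split; first by rewrite setDS ?subsetUr.
    by exists e; rewrite !inE ?eqxx ?eE' ?eE.
  - by apply: GrownS eV' => //; apply: unH.
  - by rewrite subUset sub1set eE.
  - by rewrite subUset sV (wfH e eE).
have meet e : e \in E -> e :&: V' != set0 -> e \in E'.
  by move=> eE eV'; have := none e; rewrite !inE eE eV' !andbT => /negbFE.
have clV' : closed (hadj (HGraph V E)) V'.
  apply: (intro_closed (sym_connect_sym (@hadj_sym _))) => y z.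
  case/existsP=> e /and3P[/= eE ye ze] yV'.
  apply: (subsetP (grown_sub gVE' (meet e eE _))) => //.
  by apply/set0Pn; exists y; rewrite inE ye.
have sVV' : V \subset V'.
  apply/subsetP => x xV.
  by rewrite -(closed_connect clV' (conH w x wV xV)) (grown_root gVE').
suff [-> ->] : V = V' /\ E = E' by [].
split; apply/eqP; rewrite eqEsubset ?sV ?sE andbT //.
apply/subsetP => e eE; apply: (meet e eE).
rewrite (setIidPl (subset_trans (wfH e eE) sVV')).
by rewrite -card_gt0 unH.
Qed.
End Growth.

(** * Weighted matching sums *)

Section MatchingSum.
Variables (T : finType) (R : comNzRingType).
Implicit Types (a : T -> R) (V e : {set T}) (p : T) (E M : {set {set T}}).

(** A multivariate matching polynomial: the constant weight ['X] recovers [match_poly], while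
    individual weights make room for the change at one vertex that peeling an edge causes. *)
Definition msum a V E :=
  \sum_(M : {set {set T}} | (M \subset E) && trivIset M)
    (-1) ^+ #|M| * \prod_(v in V :\: cover M) a v.

(** The factor at [p] is left out, so the free and covered sums below do not depend on [a p], and
    [msum] is affine in [a p]. *)
Definition uncovered_wt a V p M := (-1) ^+ #|M| * \prod_(v in V :\ p :\: cover M) a v.

Definition msum_free a V E p :=
  \sum_(M : {set {set T}} | [&& M \subset E, trivIset M & p \notin cover M]) uncovered_wt a V p M.

Definition msum_cov a V E p :=
  \sum_(M : {set {set T}} | [&& M \subset E, trivIset M & p \in cover M]) uncovered_wt a V p M.

Lemma msum_split a V E p : p \in V ->
  msum a V E = a p * msum_free a V E p + msum_cov a V E p.
Proof.
move=> pV; rewrite /msum (bigID (fun M => p \in cover M)) /= addrC; congr (_ + _).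
  rewrite mulr_sumr; apply: eq_big => [M|M /andP[_ pM]]; first by rewrite -andbA.
  rewrite (big_setD1 p) /=; last by rewrite inE pM.
  by rewrite setDDl setUC -setDDl mulrCA.
apply: eq_big => [M|M /andP[_ pM]]; first by rewrite -andbA.
rewrite /uncovered_wt; congr (_ * _); apply: eq_bigl => v; rewrite !inE.
by case: eqVneq => // ->; rewrite pM.
Qed.

Lemma msum_freeE a V E p :
  msum_free a V E p = msum a (V :\ p) [set e in E | p \notin e].
Proof.
apply: eq_bigl => M; rewrite [X in _ && X]andbC andbA; congr (_ && _).
apply/andP/subsetP => [[sME pM] e eM|sM].
  rewrite inE (subsetP sME) //; apply: contra pM => pe.
  by apply/bigcupP; exists e.
split; first by apply/subsetP => e /sM; rewrite inE => /andP[].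
by apply/bigcupP => -[e /sM]; rewrite inE => /andP[_ /negP].
Qed.

(** A matching of the union splits uniquely into its traces on [E1] and [E2]. Conversely, two
    matchings combine to one unless both cover [p], the only shared vertex; the three terms are the
    remaining cases. *)
Lemma msum_glue a V1 E1 V2 E2 p : V1 :&: V2 = [set p] ->
  (forall e, e \in E1 -> e \subset V1) -> (forall e, e \in E2 -> e \subset V2) ->
  [disjoint E1 & E2] ->
  msum a (V1 :|: V2) (E1 :|: E2) =
    a p * msum_free a V1 E1 p * msum_free a V2 E2 p
    + msum_cov a V1 E1 p * msum_free a V2 E2 p
    + msum_free a V1 E1 p * msum_cov a V2 E2 p.
Proof.
move=> V12 sE1 sE2 dE.
have covV V E M : (forall e, e \in E -> e \subset V) -> M \subset E -> cover M \subset V.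
  by move=> sEV sME; apply/bigcupsP => e /(subsetP sME)/sEV.
have V12P x : x \in V1 -> x \in V2 -> x = p.
  by move=> x1 x2; apply/set1P; rewrite -V12 inE x1.
have [p1 p2] : p \in V1 /\ p \in V2 by apply/setIP; rewrite V12 set11.
pose F M := (-1) ^+ #|M| * \prod_(v in (V1 :|: V2) :\: cover M) a v.
transitivity (\sum_(M1 : {set {set T}} | M1 \subset E1) \sum_(M2 : {set {set T}} | M2 \subset E2)
    if trivIset (M1 :|: M2) then F (M1 :|: M2) else 0).
  rewrite pair_big /= /msum big_mkcondr /=.
  rewrite (reindex_onto (fun P : {set {set T}} * {set {set T}} => P.1 :|: P.2)
                        (fun M => (M :&: E1, M :&: E2))) /=.
    apply: eq_bigl => -[M1 M2] /=; apply/andP/andP => [[sM /eqP[<- <-]]|[s1 s2]].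
      by rewrite !subsetIr.
    rewrite setUSS // !setIUl (setIidPl s1) (setIidPl s2).
    have /disjoint_setI0-> : [disjoint M1 & E2] by apply: disjointWl dE.
    have /disjoint_setI0-> : [disjoint M2 & E1] by rewrite disjoint_sym; apply: disjointWr dE.
    by rewrite setU0 set0U.
  by move=> M sM; rewrite -setIUr (setIidPl sM).
(* The contribution of the shared vertex: [0] if both sides cover it, [1] if exactly one does, [a p]
   if neither does. *)
pose k (b1 b2 : bool) : R := if b1 then (~~ b2)%:R else if b2 then 1 else a p.
transitivity (\sum_(M1 : {set {set T}} | (M1 \subset E1) && trivIset M1)
    \sum_(M2 : {set {set T}} | (M2 \subset E2) && trivIset M2)
    uncovered_wt a V1 p M1 * uncovered_wt a V2 p M2 * k (p \in cover M1) (p \in cover M2)).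
  rewrite [RHS]big_mkcondr /=; apply: eq_bigr => M1 s1.
  rewrite [in RHS]big_mkcondr /=.
  have c1 := covV _ _ _ sE1 s1.
  case: (boolP (trivIset M1)) => [t1|/negPf nt1]; last first.
    apply: big1 => M2 s2; case: ifP => // /trivIsetS t.
    by rewrite t ?subsetUl in nt1.
  apply: eq_bigr => M2 s2; have c2 := covV _ _ _ sE2 s2.
  case: (boolP (trivIset M2)) => [t2|/negPf nt2]; last first.
    by case: ifP => // /trivIsetS t; rewrite t ?subsetUr in nt2.
  have dM : [disjoint M1 & M2] by apply: disjointWl s1 _; apply: disjointWr s2 dE.
  case: (boolP ((p \in cover M1) && (p \in cover M2))) => [/andP[pc1 pc2]|npc].
    rewrite pc1 pc2 /k /= mulr0.
    case: ifP => // /trivIsetP t; case/bigcupP: pc1 => e1 e1M pe1.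
    case/bigcupP: pc2 => e2 e2M pe2.
    have e12 : e1 != e2.
      by apply: contraTneq e2M => <-; rewrite (disjointFr dM e1M).
    have := t e1 e2; rewrite !in_setU e1M e2M orbT => /(_ isT isT e12).
    by move/disjointFr => /(_ _ pe1); rewrite pe2.
  have dc : [disjoint cover M1 & cover M2].
    rewrite disjoint_subset; apply/subsetP => x x1; rewrite inE; apply: contra npc => x2.
    by rewrite -(V12P x (subsetP c1 x x1) (subsetP c2 x x2)) x1.
  have -> : k (p \in cover M1) (p \in cover M2) =
      \prod_(v | (v == p) && (p \notin cover M1) && (p \notin cover M2)) a v.
    move: npc; rewrite /k; case: (p \in cover M1); case: (p \in cover M2) => //= _.
    - by rewrite big_pred0 // => v; rewrite !andbF.
    - by rewrite big_pred0 // => v; rewrite !andbF.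
    - by rewrite (big_pred1 p) // => v; rewrite !andbT.
  rewrite trivIsetU // /F /uncovered_wt cardsU (disjoint_setI0 dM) cards0 subn0 exprD.
  rewrite mulrACA -!mulrA; congr (_ * (_ * _)).
  rewrite /cover bigcup_setU -!/(cover _) mulrA.
  rewrite !(big_mkcond (fun v => v \in _)) [X in _ * X]big_mkcond -!big_split /=.
  apply: eq_bigr => x _; rewrite !inE; case: eqVneq => [->|xp] /=.
    rewrite p1 p2 negb_or !andbF !andbT !mul1r.
    by [].
  rewrite mulr1; case x1 : (x \in V1); case x2 : (x \in V2);
    rewrite ?andbF ?andbT ?mulr1 ?mul1r //=.
  + by rewrite (V12P x) ?eqxx in xp.
  + by rewrite negb_or [X in _ && ~~ X](contraFF (subsetP c2 x)) ?andbT.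
  + by rewrite negb_or [X in ~~ X && _](contraFF (subsetP c1 x)).
(* Indicator factors put the free and covered sums over the same index set, so that their products
   can be compared term by term. *)
have indic V E (b : {set {set T}} -> bool) :
    \sum_(M : {set {set T}} | [&& M \subset E, trivIset M & b M]) uncovered_wt a V p M =
    \sum_(M : {set {set T}} | (M \subset E) && trivIset M) uncovered_wt a V p M * (b M)%:R.
  under eq_bigl do rewrite andbA; rewrite big_mkcondr; apply: eq_bigr => M _.
  by case: (b M); rewrite ?mulr1 ?mulr0.
rewrite /msum_free /msum_cov !indic -mulrA !big_distrlr /= mulr_sumr -!big_split /=.
apply: eq_bigr => M1 _; rewrite mulr_sumr -!big_split /=; apply: eq_bigr => M2 _.
by rewrite /k; case: (p \in cover M1); case: (p \in cover M2); rewrite /=; ring.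
Qed.

Lemma subset_set1P M e : ((M \subset [set e]) && trivIset M) = (M \in [set set0; [set e]]).
Proof.
rewrite subset1 !inE orbC; case: eqVneq => [->|_]; first by apply/trivIsetP => A B; rewrite inE.
by case: eqVneq => // ->; apply: trivIset1.
Qed.

Lemma msum_free_edge a e p : p \in e -> msum_free a e [set e] p = \prod_(c in e :\ p) a c.
Proof.
move=> pe; rewrite /msum_free (big_pred1 set0).
  by rewrite /uncovered_wt cards0 mul1r /cover big_set0 setD0.
move=> M; rewrite andbA subset_set1P !inE /=.
case: eqVneq => [->|_]; first by rewrite /cover big_set0 inE.
by case: eqVneq => // ->; rewrite cover1 pe.
Qed.

Lemma msum_cov_edge a e p : p \in e -> msum_cov a e [set e] p = -1.
Proof.
move=> pe; rewrite /msum_cov (big_pred1 [set e]).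
  by rewrite /uncovered_wt cards1 cover1 setDDl (setUidPr _) ?sub1set // setDv big_set0 mulr1.
move=> M; rewrite andbA subset_set1P !inE /=.
case: eqVneq => [->|_] /=; last by case: eqVneq => // ->; rewrite cover1 pe.
by rewrite /cover big_set0 inE; apply/esym/negbTE; rewrite eq_sym -card_gt0 cards1.
Qed.

End MatchingSum.

(** Gluing at [p] with the single edge [e] gives [a p * A * F + A * C - F], where [F] and [C] are
    the free and covered sums of [E] and [A] is the product over [e :\ p]. This equals
    [A * ((a p - A^-1) * F + C)]. *)
Lemma msum_peel (T : finType) (F : fieldType) (a : T -> F) (V e : {set T}) (E : {set {set T}}) p :
  p \in V -> e :&: V = [set p] -> (forall e, e \in E -> e \subset V) -> e \notin E ->
  \prod_(c in e :\ p) a c != 0 ->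
  msum a (e :|: V) (e |: E) = \prod_(c in e :\ p) a c *
    msum (fun v => if v == p then a p - (\prod_(c in e :\ p) a c)^-1 else a v) V E.
Proof.
move=> pV eV sE eE A0; set A := \prod_(c in _) _ in A0 *; set a' := fun v => _.
have pe : p \in e by move/setP/(_ p): eV; rewrite !inE eqxx => /andP[].
have aa' M : uncovered_wt a V p M = uncovered_wt a' V p M.
  congr (_ * _); apply: eq_bigr => v; rewrite !inE => /and3P[_ /negPf vp _].
  by rewrite /a' vp.
rewrite setUC [e |: E]setUC (@msum_glue _ _ a V E e [set e] p) ?msum_free_edge ?msum_cov_edge //.
- rewrite (msum_split a' E pV) {1}/a' eqxx -/A.
  have -> : msum_free a' V E p = msum_free a V E p by apply: eq_bigr.
  have -> : msum_cov a' V E p = msum_cov a V E p by apply: eq_bigr.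
  by field.
- by rewrite setIC.
- by move=> e'; rewrite inE => /eqP->.
- by rewrite disjoint_sym disjoints1.
Qed.

Lemma msum_imset (T T' : finType) (R : comNzRingType) (f : T -> T') (a : T' -> R)
    (V : {set T}) (E : {set {set T}}) :
  injective f ->
  msum a (f @: V) [set f @: (e : {set T}) | e in E] = msum (a \o f) V E.
Proof.
move=> fI; pose F (e : {set T}) := f @: e.
have FI : injective F by apply: imset_inj.
have covF (M : {set {set T}}) : cover (F @: M) = f @: cover M.
  rewrite /cover big_imset /=; last by move=> ? ? _ _ /FI.
  apply/setP => x; apply/bigcupP/imsetP => [[e eM /imsetP[y ye ->]]|[y /bigcupP[e eM ye] ->]].
    by exists y => //; apply/bigcupP; exists e.
  by exists e => //; apply: imset_f.
rewrite /msum (reindex_onto (fun M : {set {set T}} => F @: M) (fun M => F @^-1: M)) /=; last first.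
  move=> M /andP[sM _]; apply/setP => e; apply/imsetP/idP => [[e']|eM].
    by rewrite inE => ? ->.
  by have /imsetP[e' _ ee'] := subsetP sM e eM; exists e'; rewrite // inE -[F e']ee'.
apply: eq_big => [M|M _].
  have -> : F @^-1: (F @: M) == M.
    by apply/eqP/setP => e; rewrite inE mem_imset.
  rewrite andbT; congr (_ && _).
    apply/idP/idP => [/subsetP sM|]; last exact: imsetS.
    by apply/subsetP => e eM; rewrite -(mem_imset _ _ FI) sM // imset_f.
  by rewrite (imset_trivIset _ fI).
have -> : f @: V :\: cover (F @: M) = f @: (V :\: cover M).
  rewrite covF; apply/setP => y; apply/setDP/imsetP => [[/imsetP[x xV ->]]|[x /setDP[xV xM] ->]].
    by rewrite mem_imset // => xM; exists x; rewrite // inE xM.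
  by rewrite !mem_imset.
by rewrite card_imset // big_imset //= => ? ? _ _ /fI.
Qed.

(** Group the matchings by size. By uniformity, one with [k] edges covers exactly [k * r] vertices,
    so the exponent counts the uncovered vertices and the subtraction is never truncated. *)
Lemma match_polyE (T : finType) (r : nat) (H : hgraph T) :
  wf_hgraph H -> uniform r H -> match_poly r H = msum (fun=> 'X) (hV H) (hE H).
Proof.
move=> wfH unH.
have matchE (M : {set {set T}}) : is_matching H M = (M \subset hE H) && trivIset M.
  congr (_ && _); apply/idP/trivIsetP => [/forall_inP tM A B AM BM|tM].
    by apply/implyP; move: B BM; apply/forall_inP/tM.
  by apply/forall_inP => A AM; apply/forall_inP => B BM; apply/implyP/tM.
rewrite /msum (partition_big (fun M : {set {set T}} => inord #|M| : 'I_#|hE H|.+1) xpredT) //=.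
apply: eq_bigr => k _.
rewrite /nmatch -[X in X%:R]sum1_card natr_sum mulr_sumr scaler_suml.
apply: eq_big => [M|M].
  rewrite inE matchE; case: (boolP (M \subset _)) => //= sM; congr (_ && _).
  by rewrite -val_eqE /= inordK // ltnS subset_leq_card.
rewrite inE matchE => /andP[/andP[sM tM] /eqP Mk].
rewrite mulr1 prodr_const -Mk -mul_polyC rmorphXn rmorphN1; congr (_ * 'X^_).
have cV : cover M \subset hV H by apply/bigcupsP => e /(subsetP sM)/wfH.
rewrite cardsD (setIidPr cV); move: tM => /eqP <-.
by rewrite (eq_bigr (fun=> r)) ?sum_nat_const // => e /(subsetP sM)/unH.
Qed.

(** * Coalescences *)

Lemma msum_free_imset (T T' : finType) (R : comNzRingType) (f : T -> T') (a : T' -> R)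
    (V : {set T}) (E : {set {set T}}) p : injective f ->
  msum_free a (f @: V) [set f @: (e : {set T}) | e in E] (f p) = msum_free (a \o f) V E p.
Proof.
move=> fI; rewrite !msum_freeE -msum_imset //; congr msum.
  apply/setP => y; apply/setD1P/imsetP => [[yp /imsetP[x xV yx]]|[x /setD1P[xp xV] ->]].
    by exists x; rewrite // in_setD1 xV andbT; apply: contraNneq yp => <-; rewrite yx.
  by rewrite (inj_eq fI) mem_imset.
apply/setP => e; rewrite inE; apply/andP/imsetP => [[/imsetP[e' e'E ->]]|[e' + ->]].
  by rewrite mem_imset // => pe'; exists e'; rewrite // inE e'E.
by rewrite inE (mem_imset _ _ fI) => /andP[e'E ->]; rewrite imset_f.
Qed.

Lemma grown_imset (T T' : finType) (f : T -> T') r w (V : {set T}) E : injective f ->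
  grown r w V E -> grown r (f w) (f @: V) [set f @: (e : {set T}) | e in E].
Proof.
move=> fI; elim=> [|{}V {}E p e _ IH er eV].
  by rewrite imset_set1 imset0; apply: Grown0.
rewrite imsetU imsetU1; apply: (GrownS (p := f p)) => //.
  by rewrite card_imset.
by rewrite -imsetI ?eV ?imset_set1 // => ? ? _ _ /fI.
Qed.

(** The growth of the second part is replayed on top of the first. A new edge can meet [V1] only in
    [w], which already lies in [V2], so it still attaches at a single vertex. *)
Lemma grown_glue (T : finType) r u w (V1 V2 : {set T}) E1 E2 :
  grown r u V1 E1 -> grown r w V2 E2 -> V1 :&: V2 = [set w] ->
  grown r u (V1 :|: V2) (E1 :|: E2).
Proof.
move=> g1; elim=> [|{}V2 {}E2 p e g2 IH er eV2 V12].
  by move=> V1w; rewrite setU0 (setUidPl _) // -V1w subsetIl.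
have wV2 := grown_root g2.
have V12' : V1 :&: V2 = [set w].
  apply/eqP; rewrite eqEsubset -{1}V12 setIS ?subsetUr //= sub1set inE wV2 andbT.
  by move/setP/(_ w): V12; rewrite !inE wV2 eqxx orbT andbT.
rewrite setUCA [E1 :|: _]setUCA; apply: (GrownS (p := p)) => //; first exact: IH.
apply/eqP; rewrite eqEsubset -{2}eV2 setIS ?subsetUr // andbT -eV2.
apply/subsetP => x; rewrite !inE => /andP[xe]; rewrite xe /=.
case/orP=> // xV1; move/setP/(_ x): V12; rewrite !inE xe xV1 /= => /esym/eqP->.
exact: wV2.
Qed.

Section Coalesce.
Variables (T1 T3 : finType) (G : hgraph T1) (u : T1) (Gam : hgraph T3) (w : T3).
Hypotheses (uG : u \in hV G) (wGam : w \in hV Gam).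
Let f := coal_map u w.

Lemma coal_map_inj : injective f.
Proof. by move=> x y; rewrite /f /coal_map; do 2!case: eqVneq => [->|_] => // -[]. Qed.

Lemma coal_map_root : f w = inl u.
Proof. by rewrite /f /coal_map eqxx. Qed.

(** Putting [w] back is harmless because it is sent to [inl u]. In this form the coalescence is a
    union of two injective images with one common vertex, as the gluing lemmas require. *)
Lemma hV_coalesce : hV (coalesce G u Gam w) = (@inl T1 T3) @: hV G :|: f @: hV Gam.
Proof.
rewrite -[in RHS](setD1K wGam) imsetU1 coal_map_root setUA.
rewrite (setUidPl (_ : [set inl u] \subset _)) ?sub1set ?imset_f //=.
by congr (_ :|: _); apply: eq_in_imset => x /setD1P[/negPf xw _]; rewrite /f /coal_map xw.
Qed.

Lemma hV_coalesceI : (@inl T1 T3) @: hV G :&: f @: hV Gam = [set inl u].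
Proof.
apply/setP => y; rewrite !inE; apply/andP/eqP => [[/imsetP[x _ ->] /imsetP[z _]]|->].
  by rewrite /f /coal_map; case: eqP => // _ [->].
by split; rewrite ?imset_f // -coal_map_root imset_f.
Qed.

Lemma coalesce_grown r : grown r u (hV G) (hE G) -> grown r w (hV Gam) (hE Gam) ->
  grown r (inl u) (hV (coalesce G u Gam w)) (hE (coalesce G u Gam w)).
Proof.
move=> gG gGam; rewrite hV_coalesce; apply: (grown_glue (w := inl u)).
- by apply: grown_imset gG => x y [].
- by rewrite -coal_map_root; apply: grown_imset gGam; apply: coal_map_inj.
- exact: hV_coalesceI.
Qed.

(** In [msum_glue] at [inl u], the two terms with the free sum of [Gam] combine to the full sum of
    [G], and the covered sum of [Gam] is multiplied by the free sum of [G], that is, the sum of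
    [G - u]. Edges of [G] with at least two vertices cannot also come from [Gam]. *)
Lemma msum_coalesce (R : comNzRingType) (a : R) :
  (forall e, e \in hE G -> e \subset hV G) ->
  (forall e, e \in hE Gam -> e \subset hV Gam) ->
  (forall e, e \in hE G -> 1 < #|e|)%N ->
  msum (fun=> a) (hV (coalesce G u Gam w)) (hE (coalesce G u Gam w)) =
    msum (fun=> a) (hV G) (hE G) * msum_free (fun=> a) (hV Gam) (hE Gam) w
    + msum (fun=> a) (hV (hdel G u)) (hE (hdel G u))
      * msum_cov (fun=> a) (hV Gam) (hE Gam) w.
Proof.
move=> wfG wfGam cardG; rewrite hV_coalesce /=.
have inlI : injective (@inl T1 T3) by move=> ? ? [].
have sub (T T' : finType) (h : T -> T') (K : hgraph T) :
    (forall e, e \in hE K -> e \subset hV K) ->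
    forall e, e \in [set h @: (e : {set T}) | e in hE K] -> e \subset h @: hV K.
  by move=> wfK e /imsetP[e' /wfK e'K ->]; apply: imsetS.
rewrite (@msum_glue _ _ _ _ _ _ _ (inl u)) ?hV_coalesceI //; first 1 last.
- exact: sub.
- exact: sub.
- rewrite disjoint_subset; apply/subsetP => e eG; rewrite inE; apply/negP => eGam.
  have sub1 : e \subset [set inl u] by rewrite -hV_coalesceI subsetI !sub.
  case/imsetP: eG sub1 => e' /cardG e'1 -> /subset_leq_card.
  by rewrite cards1 card_imset // leqNgt e'1.
have covE (V : {set T1 + T3}) E : inl u \in V ->
    msum_cov (fun=> a) V E (inl u) = msum (fun=> a) V E - a * msum_free (fun=> a) V E (inl u).
  by move=> uV; rewrite (msum_split _ _ uV) addrC addKr.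
have freeG : msum_free (fun=> a) (@inl T1 T3 @: hV G)
    [set @inl T1 T3 @: (e : {set T1}) | e in hE G] (inl u) =
    msum (fun=> a) (hV (hdel G u)) (hE (hdel G u)).
  by rewrite msum_free_imset // -msum_freeE.
have freeGam : msum_free (fun=> a) (f @: hV Gam) [set f @: (e : {set T3}) | e in hE Gam] (inl u) =
    msum_free (fun=> a) (hV Gam) (hE Gam) w.
  by rewrite -coal_map_root msum_free_imset //; apply: coal_map_inj.
rewrite !covE ?imset_f //; last by rewrite -coal_map_root imset_f.
rewrite freeG freeGam !msum_imset //; last exact: coal_map_inj.
rewrite (msum_split ((fun=> a) \o _) (hE Gam) wGam) /comp; ring.
Qed.
End Coalesce.

Lemma hdel_wf (T : finType) (H : hgraph T) u : wf_hgraph H -> wf_hgraph (hdel H u).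
Proof.
by move=> wfH e; rewrite inE => /andP[/wfH eH ue]; rewrite subsetD1 eH.
Qed.

Lemma hdel_uniform (T : finType) r (H : hgraph T) u : uniform r H -> uniform r (hdel H u).
Proof. by move=> unH e; rewrite inE => /andP[/unH]. Qed.

(** * Polynomials over a real closed field *)

Section RealClosed.
Variable R : rcfType.
Implicit Types (p : {poly R}) (t B : R).

Definition eventually (P : R -> Prop) := exists B, forall t, B < t -> P t.

Lemma eventually_and P Q : eventually P -> eventually Q ->
  eventually (fun t => P t /\ Q t).
Proof.
move=> [B1 h1] [B2 h2]; exists (Num.max B1 B2) => t.
by rewrite gt_max => /andP[/h1 ? /h2].
Qed.

Lemma eventually_imp P Q : (forall t, P t -> Q t) -> eventually P -> eventually Q.
Proof. by move=> PQ [B h]; exists B => t /h/PQ. Qed.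

Lemma eventually_gt B : eventually (fun t => B < t).
Proof. by exists B. Qed.

Lemma eventually_all (I : finType) (A : {set I}) (P : I -> R -> Prop) :
  (forall i, i \in A -> eventually (P i)) ->
  eventually (fun t => forall i, i \in A -> P i t).
Proof.
move=> evP.
have /fin_all_exists[B hB] i : exists b, i \in A -> forall t, b < t -> P i t.
  case: (boolP (i \in A)) => [/evP[B h]|]; last by exists 0.
  by exists B.
exists (\big[Num.max/0]_(i in A) B i) => t ltBt i iA; apply: hB => //.
by apply: le_lt_trans ltBt; apply: le_bigmax_cond.
Qed.

Lemma eventually_ex P : eventually P -> exists t, P t.
Proof. by move=> [B h]; exists (B + 1); apply: h; rewrite ltrDl. Qed.

(** The intermediate value theorem for ['X^n - y] on [[0, 1 + y]], where
    [(1 + y)^n >= 1 + y > y]. *)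
Lemma rcf_root_exists n (y : R) : (0 < n)%N -> 0 < y -> exists2 z, 0 < z & z ^+ n = y.
Proof.
move=> n0 y0.
have y1 : 1 <= 1 + y by rewrite lerDl ltW.
have [||z] := @poly_ivt _ ('X^n - y%:P) 0 (1 + y).
- by rewrite (le_trans ler01).
- rewrite !hornerE expr0n eqn0Ngt n0 /= sub0r oppr_le0 (ltW y0) subr_ge0.
  by apply: le_trans (ler_eXnr n0 y1); rewrite lerDr ler01.
move=> /andP[z0 _]; rewrite rootE !hornerE subr_eq0 => /eqP zy.
exists z => //; rewrite lt0r z0 andbT; apply: contraTneq y0 => z00.
by rewrite -zy z00 expr0n eqn0Ngt n0 /= ltxx.
Qed.

Lemma seq_max (s : seq R) x : x \in s -> exists2 m, m \in s & forall y, y \in s -> y <= m.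
Proof.
elim: s x => // a s IH x _; case: s IH => [_|b s IH].
  by exists a; rewrite ?mem_head // => y /[1!inE] /eqP->.
have [m ms le_m] := IH b (mem_head _ _).
case: (lerP a m) => [am|/ltW ma].
  by exists m => [|y]; rewrite in_cons ?ms ?orbT // => /predU1P[->|/le_m].
by exists a => [|y]; rewrite in_cons ?eqxx // => /predU1P[->//|/le_m/le_trans->].
Qed.

Lemma gt0_of_noroot p t0 : eventually (fun t => 0 < p.[t]) ->
  (forall t, t0 < t -> ~~ root p t) -> forall t, t0 < t -> 0 < p.[t].
Proof.
move=> evp nrp t t0t; rewrite ltNge; apply/negP => pt.
have [b [/ltW pb tb]] := eventually_ex (eventually_and evp (eventually_gt t)).
have [||z] := @poly_ivt _ p t b; rewrite ?(ltW tb) ?pt //.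
by move=> /andP[tz _]; apply/negP/nrp/(lt_le_trans t0t).
Qed.

(** In the second case [mu] is the largest root. Past the last root a nonpositive value is
    impossible, since eventual positivity would force a further root. *)
Lemma last_sign_change p t0 : eventually (fun t => 0 < p.[t]) ->
  (forall t, t0 < t -> 0 < p.[t]) \/
  exists mu, [/\ t0 < mu, root p mu & forall t, mu < t -> 0 < p.[t]].
Proof.
move=> evp.
have p0 : p != 0.
  by have [t] := eventually_ex evp; apply: contraTneq => ->; rewrite horner0 ltxx.
have rootE x : (x \in rootsR p) = root p x by rewrite -(roots_on_rootsR p0) in_itv.
case: (boolP (has (> t0) (rootsR p))) => [/hasP[s sp t0s]|/hasPn none].
  right; have [mu mup mumax] := seq_max sp.
  exists mu; split; rewrite -?rootE ?(lt_le_trans t0s) ?mumax //.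
  apply: gt0_of_noroot => // t; rewrite ltNge -rootE; exact/contra/mumax.
left; apply: gt0_of_noroot => // t t0t; apply/negP; rewrite -rootE => /none.
by rewrite t0t.
Qed.

End RealClosed.

(** * Positive eigenvectors *)

Section PositiveEigenvector.
Variables (R : rcfType) (T : finType).
Implicit Types (V e : {set T}) (E : {set {set T}}) (a x : T -> R).

(** This is the eigenvalue equation at [v] multiplied by [x v], so that whole edges appear in the
    products; a constant weight [a] is an ordinary eigenvalue. *)
Definition pos_eigen r V E a x :=
  (forall v, v \in V -> 0 < x v) /\
  forall v, v \in V -> \sum_(e in E | v \in e) \prod_(j in e) x j = a v * x v ^+ r.

(** With [A] the product of the weights on [e :\ p], keep [x] on [V] and choose
    [y c ^+ r = x p ^+ r / (a c * A)] on the new vertices. The product over [e] becomes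
    [x p ^+ r / A]: this is [a c * y c ^+ r] at each new vertex [c], and at [p] it compensates
    exactly the weight change [A^-1]. *)
Lemma pos_eigen_extend r V E a a' x e p : p \in V -> e :&: V = [set p] -> #|e| = r ->
  (forall e, e \in E -> e \subset V) -> e \notin E ->
  (forall c, c \in e :\ p -> 0 < a c) ->
  a' p = a p - (\prod_(c in e :\ p) a c)^-1 ->
  (forall v, v \in V -> v != p -> a' v = a v) ->
  pos_eigen r V E a' x -> exists y, pos_eigen r (e :|: V) (e |: E) a y.
Proof.
move=> pV eV er sE eE a_gt0; set A := \prod_(c in _) a c => a'p a'V [x_gt0 xE].
have pe : p \in e by move/setP/(_ p): eV; rewrite !inE eqxx => /andP[].
have r0 : (0 < r)%N by rewrite -er; apply/card_gt0P; exists p.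
have eVp v : v \in e -> v \in V -> v = p.
  by move=> ve vV; apply/set1P; rewrite -eV inE ve.
have A_gt0 : 0 < A by apply: prodr_gt0.
have /fin_all_exists[y yP] c : exists yc, c \in e :\ p ->
    0 < yc /\ yc ^+ r = x p ^+ r / (a c * A).
  case: (boolP (c \in e :\ p)) => [cC|]; last by exists 0.
  have y_gt0 : 0 < x p ^+ r / (a c * A).
    by rewrite divr_gt0 ?exprn_gt0 ?mulr_gt0 ?x_gt0 ?a_gt0.
  by have [z z0 zr] := rcf_root_exists r0 y_gt0; exists z.
pose z v := if v \in V then x v else y v.
have zV v : v \in V -> z v = x v by rewrite /z => ->.
have zC v : v \in e :\ p -> z v = y v.
  by rewrite /z => /setD1P[vp ve]; case: ifP => // /(eVp v ve) /eqP; rewrite (negPf vp).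
have z_gt0 v : v \in e :|: V -> 0 < z v.
  case: (boolP (v \in V)) => [vV|vV]; first by rewrite zV ?x_gt0.
  rewrite inE (negPf vV) orbF => ve; have vC : v \in e :\ p.
    by rewrite !inE ve andbT; apply: contraNneq vV => ->.
  by rewrite zC //; case: (yP v vC).
(* Both sides are nonnegative, so it is enough to compare their [r]-th powers. *)
have ze : \prod_(j in e) z j = x p ^+ r / A.
  have r1 : #|e :\ p| = r.-1 by rewrite -er (cardsD1 p e) pe.
  apply/eqP; rewrite -(@eqrXn2 _ r) //; first last.
  - by rewrite divr_ge0 ?exprn_ge0 ?ltW ?x_gt0.
  - by apply: prodr_ge0 => j je; rewrite ltW // z_gt0 // inE je.
  rewrite -prodrXl (big_setD1 p) //= zV //.
  rewrite (eq_bigr (fun c => (x p ^+ r / A) / a c)); last first.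
    move=> c cC; rewrite zC //; have [_ ->] := yP c cC.
    by rewrite invfM mulrA mulrAC.
  rewrite big_split /= prodr_const r1 prodfV -/A mulrCA.
  by rewrite -exprSr prednK.
exists z; split=> // v vVe.
rewrite big_mkcondr big_setU1 //= -big_mkcondr /=.
rewrite (eq_bigr (fun e => \prod_(j in e) x j)); last first.
  by move=> e' /andP[/sE/subsetP sV _]; apply: eq_bigr => j /sV/zV.
case: (boolP (v \in V)) => vV.
  rewrite xE // zV //; case: (eqVneq v p) => [->|vp].
    by rewrite pe ze a'p; ring.
  by case: ifP => [/eVp/(_ vV)/eqP|_]; rewrite ?(negPf vp) // add0r a'V.
have ve : v \in e by rewrite inE (negPf vV) orbF in vVe.
have vC : v \in e :\ p by rewrite !inE ve andbT; apply: contraNneq vV => ->.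
rewrite ve ze big_pred0 ?addr0; last first.
  by move=> e'; apply/negP => /andP[/sE/subsetP/(_ v)] /[swap] -> /(_ isT); apply/negP.
rewrite zC //; have [_ ->] := yP v vC.
have av := a_gt0 v vC.
by field; rewrite !gt_eqF.
Qed.

End PositiveEigenvector.

Lemma eq_msum (T : finType) (R : comNzRingType) (a b : T -> R) V E :
  a =1 b -> msum a V E = msum b V E.
Proof. by move=> ab; apply: eq_bigr => M _; congr (_ * _); apply: eq_bigr => v _. Qed.

Section Perron.
Variables (R : rcfType) (T : finType) (r : nat).
Implicit Types (V e : {set T}) (E : {set {set T}}) (P Q : T -> {poly R}).

(** Peeling introduces inverses, so the weights are rational functions of [t]. Numerator and
    denominator are kept apart, with the denominator positive on the range considered, so that signs
    and zeros can be read off polynomials. *)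
Definition rweight P Q (t : R) (v : T) := (P v).[t] / (Q v).[t].

(* The nonpositive value beyond [t0] survives the peeling of a pendant edge, either at
   its old place or because the new weight of the attachment vertex tends to [-oo] at
   the last zero of the weights of the removed vertices; it forces the weight of the
   last remaining vertex to vanish somewhere beyond [t0]. *)
Lemma grown_perron w V E : (1 < r)%N -> grown r w V E -> forall (t0 : R) P Q,
  (forall v, v \in V -> forall t, t0 < t -> 0 < (Q v).[t]) ->
  (forall v, v \in V -> forall B, eventually (fun t => B <= rweight P Q t v)) ->
  (exists v s, [/\ v \in V, t0 < s & (P v).[s] <= 0]) ->
  exists mu, [/\ t0 < mu, forall t, mu < t -> 0 < msum (rweight P Q t) V E,
    msum (rweight P Q mu) V E = 0 & exists x, pos_eigen r V E (rweight P Q mu) x].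
Proof.
move=> r1; elim=> [|{}V {}E p e gVE IH er eV] t0 P Q Q_gt0 evPQ.
  case=> v [s [/set1P-> t0s Pws]].
  have wQ t : t0 < t -> 0 < (Q w).[t] by apply: Q_gt0; rewrite set11.
  have evP : eventually (fun t => 0 < (P w).[t]).
    apply: eventually_imp (eventually_and (evPQ w (set11 w) 1) (eventually_gt t0)).
    move=> t [PQ1 /wQ Qt]; have : 0 < rweight P Q t w by apply: lt_le_trans PQ1.
    by rewrite pmulr_lgt0 // invr_gt0.
  have msumE t : msum (rweight P Q t) [set w] set0 = rweight P Q t w.
    rewrite /msum (big_pred1 set0); last first.
      move=> M; rewrite subset0 /=; case: eqP => // ->.
      by apply/trivIsetP => A B; rewrite inE.
    by rewrite cards0 mul1r /cover big_set0 setD0 big_set1.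
  case: (last_sign_change t0 evP) => [/(_ s t0s)|[mu [t0mu /rootP rmu mu_gt]]].
    by rewrite ltNge Pws.
  exists mu; split=> // [t mut||].
  - by rewrite msumE divr_gt0 ?mu_gt ?wQ // (lt_trans t0mu).
  - by rewrite msumE /rweight rmu mul0r.
  exists (fun=> 1); split=> // u /set1P->.
  by rewrite /rweight rmu !mul0r big_pred0 // => e; rewrite inE.
have pV : p \in V by move/setP/(_ p): eV; rewrite !inE eqxx => /andP[].
have sE := grown_sub gVE; have eE := grown_notin r1 gVE er eV.
have Ve v : v \in V -> v \in e :|: V by rewrite inE orbC => ->.
have Ce c : c \in e :\ p -> c \in e :|: V by rewrite !inE => /andP[_ ->].
have CV c : c \in e :\ p -> c \notin V.
  move=> /setD1P[cp ce]; apply: contra cp => cV.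
  by rewrite -in_set1 -eV inE ce.
case=> v [s [vVe t0s Pvs]].
pose PA := \prod_(c in e :\ p) P c; pose QA := \prod_(c in e :\ p) Q c.
(* The new weight at [p] is [P p / Q p - QA / PA], written with denominator [Q p * PA]. *)
pose N := P p * PA - Q p * QA.
pose P' v := if v == p then N else P v; pose Q' v := if v == p then Q p * PA else Q v.
have evP c : c \in e :\ p -> eventually (fun t => 0 < (P c).[t]).
  move=> cC; have cVe := Ce c cC.
  apply: eventually_imp (eventually_and (evPQ c cVe 1) (eventually_gt t0)).
  move=> t [PQ1 /(Q_gt0 c cVe) Qt].
  have : 0 < rweight P Q t c by apply: lt_le_trans PQ1.
  by rewrite pmulr_lgt0 // invr_gt0.
have PAE t : PA.[t] = \prod_(c in e :\ p) (P c).[t] by rewrite horner_prod.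
have evPA : eventually (fun t => 0 < PA.[t]).
  by apply: eventually_imp (eventually_all evP) => t Pt; rewrite PAE; apply: prodr_gt0.
(* Beyond [t1] all weights of the removed vertices are positive, so peeling is legitimate there; the
   induction hypothesis is applied with [t1] in place of [t0]. *)
have [t1 [t01 PA_gt0 sgn]] : exists t1, [/\ t0 <= t1, forall t, t1 < t -> 0 < PA.[t] &
    (t1 = t0) \/ (t0 < t1 /\ PA.[t1] = 0)].
  case: (last_sign_change t0 evPA) => [PAt|[mu [t0mu /rootP rmu mu_gt]]].
    by exists t0; split=> //; left.
  by exists mu; split=> //; [apply: ltW | right].
have P_gt0 c t : c \in e :\ p -> t1 < t -> 0 < (P c).[t].
  move=> cC; apply: gt0_of_noroot => [|{}t t1t]; first exact: evP.
  apply/negP => /rootP Pct; have := PA_gt0 t t1t.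
  by rewrite PAE (big_setD1 c) //= Pct mul0r ltxx.
have QA_gt0 t : t0 < t -> 0 < QA.[t].
  by move=> t0t; rewrite horner_prod; apply: prodr_gt0 => c /Ce/Q_gt0; apply.
have Q'_gt0 u t : u \in V -> t1 < t -> 0 < (Q' u).[t].
  move=> uV t1t; have t0t := le_lt_trans t01 t1t.
  rewrite /Q'; case: eqVneq => [_|_]; last by rewrite Q_gt0 ?Ve.
  by rewrite hornerM mulr_gt0 ?PA_gt0 // Q_gt0 // Ve.
have AE t : \prod_(c in e :\ p) rweight P Q t c = PA.[t] / QA.[t].
  by rewrite big_split /= prodfV PAE horner_prod.
have rat' t u : t1 < t ->
    rweight P' Q' t u = if u == p then rweight P Q t p - (\prod_(c in e :\ p) rweight P Q t c)^-1
                      else rweight P Q t u.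
  move=> t1t; have t0t := le_lt_trans t01 t1t.
  rewrite /rweight /P' /Q'; case: eqVneq => // _.
  rewrite AE invf_div /N !hornerE; field.
  by rewrite !gt_eqF ?PA_gt0 // Q_gt0 ?Ve.
have ratC t c : t1 < t -> c \in e :\ p -> 0 < rweight P Q t c.
  move=> t1t cC; rewrite divr_gt0 ?P_gt0 // Q_gt0 ?Ce //; exact: le_lt_trans t1t.
have evP' u : u \in V -> forall B, eventually (fun t => B <= rweight P' Q' t u).
  move=> uV B.
  (* Once the removed weights are at least [1], so is their product, and the weight at [p] drops by
     at most [1]; hence the bound [B + 1]. *)
  have evC : eventually (fun t => forall c, c \in e :\ p -> 1 <= rweight P Q t c).
    by apply: eventually_all => c cC; apply/evPQ/Ce.
  have evu : eventually (fun t => B + 1 <= rweight P Q t u) by apply/evPQ/Ve.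
  apply: eventually_imp (eventually_and (eventually_gt t1) (eventually_and evC evu)).
  move=> t [t1t [rC ru]]; rewrite rat' //.
  have [up|_] := eqVneq u p; last by apply: le_trans ru; rewrite lerDl.
  rewrite up in ru; rewrite lerBrDr; apply: le_trans ru; rewrite lerD2l.
  rewrite invf_le1; last by apply: prodr_gt0 => c cC; apply: ratC.
  by elim/big_ind: _ => // a b; apply: mulr_ege1.
have [] := IH t1 P' Q'.
- by move=> u uV t; apply: Q'_gt0.
- exact: evP'.
(* If [t1 = t0], the removed weights are positive at [s], so [v] lies in [V] and its numerator stays
   nonpositive at [s], even when [v = p]. *)
- have [t1E|[t01' PA0]] := sgn.
    have vC : v \notin e :\ p.
      by apply/negP => vC; have := P_gt0 v s vC; rewrite t1E t0s ltNge Pvs => /(_ isT).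
    have vV : v \in V.
      move: vVe vC; rewrite !inE; case: eqVneq => [-> _ _|_ /orP[->|]] //.
    exists v, s; rewrite t1E vV t0s; split=> //; rewrite /P'.
    case: eqVneq => [vp|_] //; rewrite /N !hornerE subr_le0.
    apply: (@le_trans _ _ 0).
      by rewrite mulr_le0_ge0 -?vp // ltW // PA_gt0 // t1E.
    by rewrite mulr_ge0 // ltW ?QA_gt0 // Q_gt0 // Ve.
  (* At a zero of [PA] the numerator [N] is strictly negative, while it is nonnegative far out; its
     zero in between lies strictly beyond [t1]. *)
  have Nt1 : N.[t1] < 0.
    by rewrite /N !hornerE PA0 mulr0 sub0r oppr_lt0 mulr_gt0 ?QA_gt0 // Q_gt0 ?Ve.
  have [b [b1 t1b]] := eventually_ex (eventually_and (evP' p pV 1) (eventually_gt t1)).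
  have Nb : 0 <= N.[b].
    have := le_trans ler01 b1; rewrite /rweight {1}/P' eqxx.
    by rewrite pmulr_lge0 // invr_gt0 Q'_gt0.
  have [||z /andP[t1z zb] /rootP Nz] := @poly_ivt _ N t1 b; first exact: ltW.
    by rewrite Nb ltW.
  exists p, z; split; rewrite // ?/P' ?eqxx ?Nz // lt_neqAle t1z andbT.
  by apply: contraTneq Nt1 => ->; rewrite Nz ltxx.
move=> mu [t1mu mu_gt mu0 [x xP]].
have prodC t : t1 < t -> \prod_(c in e :\ p) rweight P Q t c != 0.
  by move=> t1t; rewrite gt_eqF // prodr_gt0 // => c; apply: ratC.
have peel t : t1 < t -> msum (rweight P Q t) (e :|: V) (e |: E) =
    \prod_(c in e :\ p) rweight P Q t c * msum (rweight P' Q' t) V E.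
  move=> t1t; rewrite (msum_peel pV eV) ?prodC //; congr (_ * _).
  by apply: eq_msum => u; rewrite rat'.
exists mu; split.
- exact: le_lt_trans t1mu.
- move=> t mut; have t1t := lt_trans t1mu mut.
  by rewrite peel // mulr_gt0 ?mu_gt // prodr_gt0 // => c; apply: ratC.
- by rewrite peel // mu0 mulr0.
apply: (pos_eigen_extend pV eV er sE eE _ _ _ xP).
- by move=> c; apply: ratC.
- by rewrite rat' // eqxx.
- by move=> u _ /negPf up; rewrite rat' // up.
Qed.
End Perron.

(** * The spectral radius *)

(** The tuples that together with [i] fill an edge [e] are the injective enumerations of the [r.-1]
    elements of [e :\ i]. There are [(r.-1)!] of them, all with the same product, which cancels the
    normalisation. *)
Lemma tensor_sumE (T : finType) (F : numFieldType) r (H : hgraph T) (x : T -> F) i :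
  uniform r H ->
  \sum_(f : {ffun 'I_r.-1 -> T} | (i |: [set f j | j : 'I_r.-1]) \in hE H)
    ((r.-1)`!%:R)^-1 * \prod_j x (f j) =
  \sum_(e in hE H | i \in e) \prod_(j in e :\ i) x j.
Proof.
move=> unH.
rewrite (partition_big (fun f : {ffun 'I_r.-1 -> T} => i |: [set f j | j : 'I_r.-1])
  (fun e => (e \in hE H) && (i \in e))) /=; last by move=> f ->; rewrite setU11.
apply: eq_bigr => e /andP[eH ie].
have eir : #|e :\ i| = r.-1 by rewrite -(unH e eH) (cardsD1 i e) ie.
have fP (f : {ffun 'I_r.-1 -> T}) : (i |: [set f j | j : 'I_r.-1] == e) =
    (f \in [set f in ffun_on (mem (e :\ i)) | injectiveb f]).
  rewrite inE; apply/eqP/andP => [fe|[/ffun_onP fon /injectiveP finj]].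
    have sub : e :\ i \subset [set f j | j : 'I_r.-1].
      by apply/subsetP => y; rewrite -fe !inE => /andP[/negPf->].
    have le_r : (#|[set f j | j : 'I_r.-1]| <= #|e :\ i|)%N.
      by rewrite eir; apply: leq_trans (leq_imset_card _ _) _; rewrite card_ord.
    have /eqP imf : e :\ i == [set f j | j : 'I_r.-1] by rewrite eqEcard sub.
    split; first by apply/ffun_onP => j; rewrite imf imset_f.
    have /imset_injP inj : #|[set f j | j : 'I_r.-1]| == #|'I_r.-1| by rewrite -imf eir card_ord.
    by apply/injectiveP => j k; apply: inj.
  have /eqP -> : [set f j | j : 'I_r.-1] == e :\ i.
    rewrite eqEcard eir card_imset // card_ord leqnn andbT.
    by apply/subsetP => y /imsetP[j _ ->].
  by rewrite setD1K.
rewrite (eq_bigr (fun=> ((r.-1)`!%:R)^-1 * \prod_(j in e :\ i) x j)).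
  rewrite (eq_bigl (fun f : {ffun 'I_r.-1 -> T} =>
      f \in [set f in ffun_on (mem (e :\ i)) | injectiveb f])).
    rewrite sumr_const card_inj_ffuns_on card_ord -mulrnAl.
    have -> : #|(mem (e :\ i))| = r.-1 by rewrite -[RHS]eir; apply: eq_card.
    by rewrite ffactnn -mulr_natl mulfV ?mul1r // pnatr_eq0 -lt0n fact_gt0.
  by move=> f; rewrite -fP; case: eqP => [->|]; rewrite ?eH ?andbF.
move=> f /andP[_ ]; rewrite fP inE => /andP[/ffun_onP fon /injectiveP finj].
congr (_ * _); have <- : [set f j | j : 'I_r.-1] = e :\ i.
  apply/eqP; rewrite eqEcard eir card_imset // card_ord leqnn andbT.
  by apply/subsetP => y /imsetP[j _ ->].
by rewrite big_imset //= => ? ? _ _ /finj.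
Qed.

Lemma tensor_eigenvalueE (R : realType) (T : finType) r (H : hgraph T) (l : R[i]) :
  uniform r H -> tensor_eigenvalue r H l <->
  exists x : T -> R[i], (exists2 i, i \in hV H & x i != 0) /\
    forall i, i \in hV H ->
      \sum_(e in hE H | i \in e) \prod_(j in e :\ i) x j = l * x i ^+ r.-1.
Proof.
move=> unH; split=> -[x [x0 xE]]; exists x; split=> // i iV.
  by rewrite -(xE i iV); apply/esym/(@tensor_sumE _ R[i]).
by rewrite -(xE i iV); apply: (@tensor_sumE _ R[i]).
Qed.

Section SpectralRadius.
Variables (R : realType) (T : finType) (r : nat) (H : hgraph T).
Hypotheses (r0 : (0 < r)%N) (wfH : wf_hgraph H) (unH : uniform r H).
Variables (mu : R) (y : T -> R).
Hypothesis yP : pos_eigen r (hV H) (hE H) (fun=> mu) y.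

Lemma pos_eigen_div i : i \in hV H ->
  \sum_(e in hE H | i \in e) \prod_(j in e :\ i) y j = mu * y i ^+ r.-1.
Proof.
have [y_gt0 yE] := yP; move=> iV; apply: (mulfI (lt0r_neq0 (y_gt0 i iV))).
rewrite mulr_sumr mulrCA -exprS prednK // -yE //.
by apply: eq_bigr => e /andP[_ ie]; rewrite [RHS](big_setD1 i).
Qed.

Lemma pos_eigen_tensor : hV H != finset.set0 -> tensor_eigenvalue r H (mu%:C)%C.
Proof.
case/set0Pn=> i0 i0V; apply/tensor_eigenvalueE => //.
exists (fun v => real_complex R (y v)); split.
  by exists i0 => //; rewrite fmorph_eq0 gt_eqF //; apply: yP.1.
move=> i iV; rewrite -rmorphXn -[(mu%:C)%C]/(real_complex R mu) -rmorphM -pos_eigen_div //.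
by rewrite rmorph_sum; apply: eq_bigr => e _; rewrite rmorph_prod.
Qed.

Lemma normr_normc (z : R[i]) : `|z| = (Normc.normc z)%:C%C.
Proof. by case: z. Qed.

(** Choose [i] maximising the ratio [m] of the modulus of [x i] to [y i]. The triangle inequality at
    [i], followed by [n j <= m * y j] and the equation for [y], bounds [Normc.normc l * n i ^+ r.-1]
    by [mu * n i ^+ r.-1], and [n i > 0]. *)
Lemma tensor_eigenvalue_le (l : R[i]) : tensor_eigenvalue r H l -> Normc.normc l <= mu.
Proof.
case/tensor_eigenvalueE=> // x [[i0 i0V xi0] xE]; have [y_gt0 _] := yP.
pose n j := Normc.normc (x j).
have nE j : `|x j| = (n j)%:C%C by apply: normr_normc.
have n_ge0 j : 0 <= n j by rewrite -ler0c -nE normr_ge0.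
have [i iV imax] : exists2 i, i \in hV H & forall j, j \in hV H -> n j / y j <= n i / y i.
  by case: (@arg_maxP _ _ _ i0 (mem (hV H)) (fun j => n j / y j) i0V) => i; exists i.
set m := n i / y i in imax.
have ni : n i = m * y i by rewrite divfK // gt_eqF ?y_gt0.
have n_le j : j \in hV H -> n j <= m * y j.
  by move=> jV; rewrite -ler_pdivrMr ?y_gt0 // imax.
have m_gt0 : 0 < m.
  rewrite -(pmulr_lgt0 _ (y_gt0 i0 i0V)); apply: lt_le_trans (n_le i0 i0V).
  by rewrite -(@ltcR R) -nE normr_gt0.
rewrite -(ler_pM2r (_ : 0 < n i ^+ r.-1)); last by rewrite exprn_gt0 // ni mulr_gt0 ?y_gt0.
have -> : mu * n i ^+ r.-1 = \sum_(e in hE H | i \in e) \prod_(j in e :\ i) (m * y j).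
  rewrite ni exprMn mulrCA -pos_eigen_div // mulr_sumr.
  apply: eq_bigr => e /andP[eH ie]; rewrite big_split prodr_const /=.
  by rewrite -(unH eH) [#|e|](cardsD1 i) ie.
apply: (@le_trans _ _ (\sum_(e in hE H | i \in e) \prod_(j in e :\ i) n j)).
  rewrite -lecR rmorphM rmorphXn /= -!normr_normc -normrX -normrM -xE //.
  apply: le_trans (ler_norm_sum _ _ _) _; rewrite rmorph_sum ler_sum // => e _.
  by rewrite normr_prod rmorph_prod ler_prod // => j _; rewrite normr_ge0 normr_normc /=.
apply: ler_sum => e /andP[eH _]; apply: ler_prod => j /setD1P[_ je].
by rewrite n_ge0 n_le // (subsetP (wfH eH)).
Qed.

(** The supremum is attained: [mu] is itself an eigenvalue, and it equals its modulus because the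
    positive solution forces [mu >= 0]. *)
Lemma spectral_radius_pos_eigen : hV H != finset.set0 -> spectral_radius R r H = mu.
Proof.
move=> V0; have mu_ge0 : 0 <= mu.
  have /set0Pn[i iV] := V0; have [y_gt0 yE] := yP.
  rewrite -(pmulr_lge0 _ (exprn_gt0 r (y_gt0 i iV))) -yE //.
  apply: sumr_ge0 => e /andP[eH _]; apply: prodr_ge0 => j je.
  by rewrite ltW // y_gt0 // (subsetP (wfH eH)).
have normmu : Normc.normc (mu%:C)%C = mu.
  by rewrite /= expr0n addr0 sqrtr_sqr ger0_norm.
have ubmu : ubound [set z : R | exists l, tensor_eigenvalue r H l /\ z = Normc.normc l]%classic mu.
  by move=> _ [l [lP ->]]; apply: tensor_eigenvalue_le.
have memmu : [set z : R | exists l, tensor_eigenvalue r H l /\ z = Normc.normc l]%classic mu.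
  by exists (mu%:C)%C; split=> //; apply: pos_eigen_tensor.
apply/eqP; rewrite eq_le; apply/andP; split.
  by apply: ge_sup => //; exists mu.
by apply: ub_le_sup => //; exists mu.
Qed.
End SpectralRadius.

(** * Matching polynomials of coalescences and their largest roots *)

Lemma msum_rmorph (T : finType) (R S : comNzRingType) (phi : {rmorphism R -> S})
    (a : T -> R) V E : phi (msum a V E) = msum (phi \o a) V E.
Proof.
rewrite rmorph_sum; apply: eq_bigr => M _.
by rewrite rmorphM rmorphXn rmorphN1 rmorph_prod.
Qed.

Lemma match_poly_horner (T : finType) (R : comNzRingType) r (H : hgraph T) (t : R) :
  wf_hgraph H -> uniform r H ->
  (map_poly intr (match_poly r H)).[t] = msum (fun=> t) (hV H) (hE H).
Proof.
move=> wfH unH; rewrite match_polyE // msum_rmorph -[_.[t]]/(horner_eval t _) msum_rmorph.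
by apply: eq_msum => v; rewrite /= map_polyX /horner_eval hornerX.
Qed.

Lemma coalesce_match_poly (T1 T3 : finType) r (G : hgraph T1) u (Gam : hgraph T3) w :
  (1 < r)%N -> wf_hgraph G -> uniform r G -> wf_hgraph Gam -> uniform r Gam ->
  u \in hV G -> w \in hV Gam ->
  wf_hgraph (coalesce G u Gam w) -> uniform r (coalesce G u Gam w) ->
  match_poly r (coalesce G u Gam w) =
    match_poly r G * msum_free (fun=> 'X) (hV Gam) (hE Gam) w
    + match_poly r (hdel G u) * msum_cov (fun=> 'X) (hV Gam) (hE Gam) w.
Proof.
move=> r1 wfG unG wfGam unGam uG wGam wfK unK.
rewrite !match_polyE //; [|exact: hdel_wf|exact: hdel_uniform].
by rewrite msum_coalesce // => e /unG->.
Qed.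

(** The two properties single out the spectral radius as the largest real root, hence as a quantity
    read off the matching polynomial alone. *)
Lemma grown_spectral_radius (R : realType) (T : finType) r w (H : hgraph T) :
  (1 < r)%N -> grown r w (hV H) (hE H) ->
  root (map_poly intr (match_poly r H)) (spectral_radius R r H) /\
  forall t, spectral_radius R r H < t -> 0 < (map_poly intr (match_poly r H)).[t].
Proof.
move=> r1 gH; have wV := grown_root gH.
have wfH : wf_hgraph H by apply: grown_sub gH.
have unH : uniform r H by apply: grown_card gH.
have ratE (t : R) v : @rweight R T (fun=> 'X) (fun=> 1) t v = t.
  by rewrite /rweight !hornerE invr1 mulr1.
(* The initial weight is ['X / 1]. Its nonpositive value is taken at [0], which must lie strictly
   above [t0], whence [-1]. *)
have [|||mu [_ mu_gt mu0 [x [x_gt0 xE]]]] :=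
    @grown_perron R T r w _ _ r1 gH (-1) (fun=> 'X) (fun=> 1).
- by move=> v _ t _; rewrite hornerE.
- move=> v _ B; exists B => t /ltW; by rewrite ratE.
- by exists w, 0; rewrite wV hornerX oppr_lt0 ltr01.
have -> : spectral_radius R r H = mu.
  apply: (@spectral_radius_pos_eigen _ _ _ _ _ wfH unH _ x); first exact: ltnW.
    by split=> // v vV; rewrite xE // ratE.
  by apply/set0Pn; exists w.
split=> [|t mut]; rewrite ?rootE match_poly_horner //.
  by rewrite -mu0; apply/eqP/eq_msum => v; rewrite ratE.
by move: (mu_gt t mut); rewrite (eq_msum (b := fun=> t)).
Qed.

Theorem theorem1 (R : realType) (r : nat) (T1 T2 T3 : finType)
    (G : hgraph T1) (H : hgraph T2) (Gam : hgraph T3) (u : T1) (v : T2) :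
  (3 <= r)%N ->
  supertree r G -> supertree r H -> supertree r Gam ->
  #|hV G| = #|hV H| ->
  u \in hV G -> v \in hV H ->
  match_poly r G = match_poly r H ->
  match_poly r (hdel G u) = match_poly r (hdel H v) ->
  forall w : T3, w \in hV Gam ->
    spectral_radius R r (coalesce G u Gam w) = spectral_radius R r (coalesce H v Gam w)
    /\ match_energy R r (coalesce G u Gam w) = match_energy R r (coalesce H v Gam w).
Proof.
move=> r3 tG tH tGam _ uG vH eqGH eqGHdel w wGam.
have r1 := ltnW r3; have r0 := ltnW r1.
have gK1 := coalesce_grown uG wGam (supertree_grown r0 tG uG) (supertree_grown r0 tGam wGam).
have gK2 := coalesce_grown vH wGam (supertree_grown r0 tH vH) (supertree_grown r0 tGam wGam).
have eqK : match_poly r (coalesce G u Gam w) = match_poly r (coalesce H v Gam w).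
  case: tG tH tGam => [wfG unG _ _] [wfH unH _ _] [wfGam unGam _ _].
  rewrite !coalesce_match_poly ?eqGH ?eqGHdel //.
  - exact: grown_sub gK2.
  - exact: grown_card gK2.
  - exact: grown_sub gK1.
  - exact: grown_card gK1.
split; last by rewrite /match_energy /match_roots eqK.
have [root1 pos1] := grown_spectral_radius R r1 gK1.
have [root2 pos2] := grown_spectral_radius R r1 gK2.
rewrite eqK in root1 pos1.
set rho1 := spectral_radius _ _ _ in root1 pos1 *.
set rho2 := spectral_radius _ _ _ in root2 pos2 *.
(* If the two differed, the larger would be a root lying where the common polynomial is positive. *)
case: (ltgtP rho1 rho2) => // [/pos1|/pos2].
  by rewrite (rootP root2) ltxx.
by rewrite (rootP root1) ltxx.
Qed.
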